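(* Let $\mathbb P$ be a probability measure on $(\Omega,\mathcal F)$ satisfying the Markov property $$\mathbb E^{\mathbb P}[F((X_u)_{u\in[t,T]})\mid\mathcal F_t]=\mathbb E^{\mathbb P}[F((X_u)_{u\in[t,T]})\mid X_t]\quad \mathbb P\text{-a.s.}$$ for all $t\in[0,T]$ and all bounded Borel $F:D([t,T],\mathbb R^d)\to\mathbb R$. Let $f:[0,T]\times\mathbb R^d\to[0,+\infty)$ be Borel with $\int_0^T f(r,X_r)\,dr<+\infty$ $\mathbb P$-a.s., and let $g:\mathbb R^d\to\mathbb R$ be Borel (not necessarily non-negative) such that $\exp(-g(X_T))\in L^1(\mathbb P)$. Let $\mathbb Q$ be the probability measure defined by $d\mathbb Q=D_T\,d\mathbb P$ with $$D_T=\frac{\exp\left(-\int_0^T f(r,X_r)\,dr-g(X_T)\right)}{\mathbb E^{\mathbb P}\left[\exp\left(-\int_0^T f(r,X_r)\,dr-g(X_T)\right)\right]}.$$ Then $\mathbb Q$ satisfies the same Markov property, i.e. for all $t\in[0,T]$ and all bounded Borel $F:D([t,T],\mathbb R^d)\to\mathbb R$, $$\mathbb E^{\mathbb Q}[F((X_u)_{u\in[t,T]})\mid\mathcal F_t]=\mathbb E^{\mathbb Q}[F((X_u)_{u\in[t,T]})\mid X_t]\quad \mathbb Q\text{-a.s.}$$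
   Context: $T>0$ and $d\ge1$ are fixed. $D([t,T],\mathbb R^d)$ is the space of càdlàg functions on $[t,T]$ with values in $\mathbb R^d$, $\Omega=D([0,T],\mathbb R^d)$, $X_t(\omega)=\omega_t$ is the canonical process, $\mathcal F=\sigma(X_r,0\le r\le T)$, and $\mathcal F_t=\bigcap_{t<s\le T}\sigma(X_r,0\le r\le s)$ for $t<T$, $\mathcal F_T=\mathcal F$. *)

(* Defs.v *)
From HB Require Import structures.
From mathcomp Require Import all_boot all_order all_algebra.
From mathcomp Require Import all_classical all_reals all_analysis.

Set Implicit Arguments.
Unset Strict Implicit.
Unset Printing Implicit Defensive.

Import Order.TTheory GRing.Theory Num.Theory.
Import numFieldNormedType.Exports.

Local Open Scope classical_set_scope.
Local Open Scope ring_scope.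

(* E equipped with its Borel sigma-algebra *)
Notation borel E := (g_sigma_algebraType (open : set (set E))).

Section cadlag_space.
Context {R : realType} {d : nat}.

Definition is_cadlag (a b : R) (x : R -> 'rV[R]_d) :=
  (forall r, a <= r < b -> x u @[u --> r^'+] --> x r) /\
  (forall r, a < r <= b -> cvg (x u @[u --> r^'-])).

(* The space D([a, b], R^d). An element is encoded as a function on the whole
   of R that vanishes outside [a, b], so that two elements are equal exactly
   when they agree on [a, b]. *)
Record cadlag (a b : R) := Cadlag {
  path_of :> R -> 'rV[R]_d;
  path_of_cadlag : is_cadlag a b path_of;
  path_of_out : forall r, r \notin `[a, b] -> path_of r = 0 }.

Lemma is_cadlag0 (a b : R) : is_cadlag a b (fun=> 0).
Proof.
by split=> r _; [exact: cvg_cst | apply/cvg_ex; exists 0; exact: cvg_cst].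
Qed.

HB.instance Definition _ (a b : R) := gen_eqMixin (cadlag a b).
HB.instance Definition _ (a b : R) := gen_choiceMixin (cadlag a b).
HB.instance Definition _ (a b : R) := isPointed.Build (cadlag a b)
  (Cadlag (is_cadlag0 a b) (fun _ _ => erefl)).

Definition coord_at {a b : R} (r : R) (x : cadlag a b) : borel 'rV[R]_d := x r.

(* sigma(X_r, a <= r <= s) on D([a, b], R^d) *)
Definition coord_sigma {a b : R} (s : R) : set_system (cadlag a b) :=
  <<s \bigcup_(r in `[a, s]) g_sigma_algebra_preimage (coord_at r) >>.

Lemma coord_sigma0 (a b s : R) : (coord_sigma s : set_system (cadlag a b)) set0.
Proof. exact: sigma_algebra0. Qed.

Lemma coord_sigmaC (a b s : R) (A : set (cadlag a b)) :
  coord_sigma s A -> coord_sigma s (~` A).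
Proof. exact: sigma_algebraC. Qed.

Lemma coord_sigma_bigcup (a b s : R) (A : (set (cadlag a b))^nat) :
  (forall i, coord_sigma s (A i)) -> coord_sigma s (\bigcup_i A i).
Proof. exact: sigma_algebra_bigcup. Qed.

Definition cadlag_display (a b : R) : measure_display.
Proof. by constructor. Qed.

(* D([a, b], R^d) carries sigma(X_r, a <= r <= b), which is also the Borel
   sigma-algebra of the Skorokhod topology. *)
HB.instance Definition _ (a b : R) :=
  @isMeasurable.Build (cadlag_display a b) (cadlag a b) (coord_sigma b)
    (@coord_sigma0 a b b) (@coord_sigmaC a b b) (@coord_sigma_bigcup a b b).

Lemma is_cadlag_restr (a b t : R) (x : cadlag a b) : a <= t ->
  is_cadlag t b (fun u => if t <= u then x u else 0).
Proof.
move=> at_; have [xr xl] := path_of_cadlag x; split=> r /andP[].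
- move=> tr rb; rewrite tr.
  have /xr : a <= r < b by rewrite (le_trans at_ tr).
  apply: cvg_trans; apply: near_eq_cvg; near=> u.
  rewrite ifT//; apply: (le_trans tr); apply: ltW.
  by near: u; exact: nbhs_right_gt.
- move=> tr rb.
  have /xl /cvg_ex[l xrl] : a < r <= b by rewrite (le_lt_trans at_ tr).
  apply/cvg_ex; exists l; move: xrl; apply: cvg_trans.
  apply: near_eq_cvg; near=> u.
  by rewrite ifT//; apply: ltW; near: u; exact: nbhs_left_gt.
Unshelve. all: by end_near. Qed.

Lemma restr_out (a b t : R) (x : cadlag a b) (r : R) : r \notin `[t, b] ->
  (if t <= r then x r else 0) = 0.
Proof.
rewrite in_itv/= negb_and -!ltNge => /orP[rt|br]; first by rewrite leNgt rt.
by rewrite path_of_out ?if_same// in_itv/= negb_and -!ltNge br orbT.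
Qed.

(* x |-> (x_u)_{u in [t, b]} *)
Definition restr (a b t : R) (at_ : a <= t) (x : cadlag a b) : cadlag t b :=
  Cadlag (is_cadlag_restr x at_) (@restr_out a b t x).

(* the right-continuous filtration, F_t being the whole sigma-algebra at t = T *)
Definition filtr (T t : R) : set_system (cadlag 0 T) :=
  if t < T then \bigcap_(s in `]t, T]) coord_sigma s else measurable.

End cadlag_space.

Section conditional_expectation.
Context {dT : measure_display} {W : measurableType dT} {R : realType}.

(* Z is a version of E^P[Y | G], for G a sub-sigma-algebra of measurable *)
Definition is_condexp (P : probability W R) (G : set_system W) (Y Z : W -> R) :=
  [/\ forall B : set R, measurable B -> G (Z @^-1` B),
      P.-integrable [set: W] (EFin \o Z) &
      forall A, G A ->
        (\int[P]_(w in A) (Z w)%:E = \int[P]_(w in A) (Y w)%:E)%E].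

(* E^P[Y | G]: some version of it (unique up to P-null sets, and existing for
   integrable Y), and 0 if there is none *)
Definition condexp (P : probability W R) (G : set_system W) (Y : W -> R) :
    W -> R :=
  xget (fun=> 0) [set Z | is_condexp P G Y Z].

End conditional_expectation.

Definition markov_property (R : realType) (d : nat) (T : R)
    (P : probability (@cadlag R d 0 T) R) :=
  forall (t : R) (t0 : 0 <= t) (tT : t <= T) (F : @cadlag R d t T -> R),
    measurable_fun [set: cadlag t T] F -> bounded_fun F ->
    {ae P, forall w, condexp P (filtr t) (F \o restr t0) w =
                     condexp P (g_sigma_algebra_preimage (coord_at t))
                       (F \o restr t0) w}.

Section feynman_kac.
Context {R : realType} {d : nat} {T : R}.
Variables (f : R * 'rV[R]_d -> R) (g : 'rV[R]_d -> R).

(* The integral is real-valued, with value 0 where it diverges; this only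
   matters on a P-null set. *)
Definition fk_weight (w : @cadlag R d 0 T) : R :=
  expR (- (\int[lebesgue_measure]_(r in `[0, T]) f (r, w r)) - g (w T)).

Definition fk_density (P : probability (@cadlag R d 0 T) R)
    (w : @cadlag R d 0 T) : R :=
  fk_weight w / fine 'E_P[fk_weight].

End feynman_kac.

(* Main.v *)
Require Import Defs.
From HB Require Import structures.
From mathcomp Require Import all_boot all_order all_algebra.
From mathcomp Require Import all_classical all_reals all_analysis.
From mathcomp Require Import measurable_realfun.

Set Implicit Arguments.
Unset Strict Implicit.
Unset Printing Implicit Defensive.

Import Order.TTheory GRing.Theory Num.Theory.
Import numFieldNormedType.Exports.

Local Open Scope classical_set_scope.
Local Open Scope ring_scope.

(** Fix a time t, write X for the position at time t, U for the path on [t, T]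
    and F for the sigma-algebra of the past. Splitting the time integral at t
    factors the density of Q with respect to P as K * b(U), where
    K = exp (- \int_0^t f(r, X_r) dr) is F-measurable and b(U), the remaining
    exponential divided by the normalising constant, is a function of the
    future path. For a bounded function y >= 0 of the future, Bayes' formula
    then gives
      E^Q[y(U) | F] = E^P[y(U) b(U) | F] / E^P[b(U) | F];
    the factor K cancels because it is F-measurable. By the Markov property of
    P both conditional expectations on the right are functions of X, hence so
    is their quotient, which is therefore also E^Q[y(U) | X].

    All of this is done with integrals of non-negative functions. The main tool
    is [pull_out]: two densities with the same mass on every event of the form
    [X in B] have the same integral against every non-negative function of X.
    It gives at once the formula for integration against Q and the usual rules
    for taking known factors out of a conditional expectation. Conditional
    expectations given a random variable are produced, as functions of that
    variable, by the Radon-Nikodym theorem ([factored_condexp]).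

    Two points need more than this computation. The Markov property of P is
    stated for bounded functions of the future, whereas b is only integrable:
    [indic_condexp_integrable] passes from indicators to integrable functions
    through the symmetric form of conditional independence. And one has to know
    that K and b are measurable for the past and the future: this is progressive
    measurability of right-continuous processes ([measurable_time_path]),
    followed by Tonelli's theorem ([measurable_path_integral]). *)

(** * Integrals against densities *)

Section pull_out.
Context {d d' : measure_display} {W : measurableType d} {S : measurableType d'}
  {R : realType}.
Implicit Types (mu : {measure set W -> \bar R}) (H : W -> R).

Import HBNNSimple.

Lemma integral_mul_indic mu (A D : set W) H :
  (\int[mu]_(x in D) (\1_A x * H x)%:E = \int[mu]_(x in D `&` A) (H x)%:E)%E.
Proof.
rewrite integral_mkcondr; apply: eq_integral => x _.
rewrite patchE indicE; case: ifPn => xA; first by rewrite mul1r.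
by rewrite mul0r.
Qed.

(** The right-hand side involves [H] and [mu] only through the masses of the
    events in the sigma-algebra generated by [X]; this is what makes [pull_out]
    true for simple functions. *)
Lemma integral_mul_simple mu (X : W -> S) H (h : {nnsfun S >-> R}) :
  measurable_fun setT X -> measurable_fun setT H -> (forall x, 0 <= H x) ->
  (\int[mu]_x (h (X x) * H x)%:E =
   \sum_(k \in range h)
     k%:E * \int[mu]_(x in X @^-1` (h @^-1` [set k])) (H x)%:E)%E.
Proof.
move=> mX mH H0.
have mXh k : measurable (X @^-1` (h @^-1` [set k])).
  by rewrite -[X in measurable X]setTI; apply: mX => //; exact: measurable_sfunP.
transitivity (\int[mu]_x \sum_(k \in range h)
    (k * (\1_(X @^-1` (h @^-1` [set k])) x * H x))%:E)%E.
  apply: eq_integral => x _; rewrite fimfunE fsumEFin// mulr_fsuml//.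
  by congr (_%:E); apply: eq_fsbigr => k _; rewrite mulrA.
have ind_ge0 k x : 0 <= \1_(X @^-1` (h @^-1` [set k])) x * H x.
  by apply: mulr_ge0.
have mind k : measurable_fun setT
    (fun x => \1_(X @^-1` (h @^-1` [set k])) x * H x).
  exact: measurable_funM.
rewrite ge0_integral_fsum//.
- apply: eq_fsbigr => k; rewrite inE => -[s _ hs].
  under eq_integral do rewrite EFinM.
  rewrite ge0_integralZl_EFin//; first by rewrite integral_mul_indic setTI.
  + by move=> x _; rewrite lee_fin.
  + exact/measurable_EFinP.
  + by rewrite -hs.
- by move=> k; apply/measurable_EFinP; exact: measurable_funM.
- move=> k x _; rewrite lee_fin.
  have [[s _ hs]|nk] := pselect (range h k); first by rewrite mulr_ge0// -hs.
  rewrite indicE (_ : _ \in _ = false) ?mul0r ?mulr0//.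
  by apply/negbTE; rewrite notin_setE => /= hk; apply: nk; exists (X x).
Qed.

(** Both integrals are limits of integrals of simple functions of [X], by
    monotone convergence. With [mu1 = mu2] this takes functions of [X] out of a
    conditional expectation given [X]; with [X] the identity and [H1 = 1] it
    integrates against a measure that has a density. *)
Lemma pull_out mu1 mu2 (X : W -> S) H1 H2 (s : S -> R) :
  measurable_fun setT X ->
  measurable_fun setT H1 -> (forall x, 0 <= H1 x) ->
  measurable_fun setT H2 -> (forall x, 0 <= H2 x) ->
  (forall B, measurable B -> (\int[mu1]_(x in X @^-1` B) (H1 x)%:E =
                              \int[mu2]_(x in X @^-1` B) (H2 x)%:E)%E) ->
  measurable_fun setT s -> (forall x, 0 <= s x) ->
  (\int[mu1]_x (s (X x) * H1 x)%:E = \int[mu2]_x (s (X x) * H2 x)%:E)%E.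
Proof.
move=> mX mH1 H10 mH2 H20 H12 ms s0.
have msE : measurable_fun setT (EFin \o s) by exact/measurable_EFinP.
pose h := nnsfun_approx measurableT msE.
have lim_h mu H : measurable_fun setT H -> (forall x, 0 <= H x) ->
    (\int[mu]_x (s (X x) * H x)%:E =
     limn (fun n => \int[mu]_x (h n (X x) * H x)%:E))%E.
  move=> mH H0; rewrite -monotone_convergence//.
  - apply: eq_integral => x _; apply/esym/cvg_lim => //=.
    under eq_fun do rewrite EFinM.
    rewrite EFinM; apply: cvgeZr => //.
    apply: (@cvg_nnsfun_approx _ _ _ _ measurableT _ msE) => // y _.
    by rewrite lee_fin.
  - move=> n; apply/measurable_EFinP/measurable_funM => //.
    exact: measurableT_comp.
  - by move=> n x _; rewrite lee_fin mulr_ge0.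
  - move=> x _ m n mn; rewrite lee_fin ler_wpM2r//.
    exact/lefP/nd_nnsfun_approx.
rewrite !lim_h//; congr (limn _); apply/funext => n.
rewrite !integral_mul_simple//; apply: eq_fsbigr => k _.
by rewrite H12.
Qed.

End pull_out.

(** * Conditional expectations as functions of a random variable *)

Section factored_condexp.
Context {d d' : measure_display} {W : measurableType d} {S : measurableType d'}
  {R : realType}.
Variables (P : probability W R) (X : W -> S) (Y : W -> R).
Hypothesis mX : measurable_fun setT X.
Hypotheses (Y0 : forall x, 0 <= Y x) (intY : P.-integrable setT (EFin \o Y)).

Let mY : measurable_fun setT (EFin \o Y) := measurable_int _ intY.

Let mpre B : measurable B -> measurable (X @^-1` B).
Proof. by move=> mB; rewrite -[_ @^-1` _]setTI; exact: mX. Qed.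

Let nu (B : set S) : \bar R := (\int[P]_(x in X @^-1` B) (Y x)%:E)%E.

Let nu0 : nu set0 = 0%E.
Proof. by rewrite /nu preimage_set0 integral_set0. Qed.

Let nu_ge0 B : (0 <= nu B)%E.
Proof. by apply: integral_ge0 => x _; rewrite lee_fin. Qed.

Let nu_sigma_additive : semi_sigma_additive nu.
Proof.
move=> F mF tF mUF; rewrite /nu preimage_bigcup.
apply: (@semi_sigma_additive_nng_induced _ _ _ P (EFin \o Y) mY).
- by move=> x; rewrite lee_fin.
- by move=> n; exact: mpre.
- apply/trivIsetP => /= i j _ _ ij; rewrite -preimage_setI.
  by move/trivIsetP : tF => /(_ _ _ _ _ ij) ->//; rewrite preimage_set0.
- by rewrite -preimage_bigcup; exact: mpre.
Qed.

HB.instance Definition _ := isMeasure.Build _ _ _ nu nu0 nu_ge0 nu_sigma_additive.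

Let nu_fin : fin_num_fun nu.
Proof.
move=> B mB; apply: integrable_fin_num; first exact: mpre.
by apply: integrableS intY => //; exact: mpre.
Qed.

HB.instance Definition _ := Measure_isFinite.Build _ _ _ nu nu_fin.

(** [y] is the Radon-Nikodym derivative, with respect to the law of [X], of the
    image under [X] of the measure with density [Y]. *)
Lemma factored_condexp : exists y : S -> R,
  [/\ measurable_fun setT y, forall x, 0 <= y x &
    forall B, measurable B ->
      (\int[P]_(x in X @^-1` B) (y (X x))%:E =
       \int[P]_(x in X @^-1` B) (Y x)%:E)%E].
Proof.
pose X' : {mfun W >-> S} := HB.pack X (isMeasurableFun.Build _ _ _ _ X mX).
have : nu `<< distribution P X'.
  apply/null_content_dominatesP => B mB PB0.
  apply: null_set_integral; first exact: mpre.
  - exact: measurable_funTS.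
  - exact: PB0.
move=> /radon_nikodym_sigma_finite[f [f0 ffin intf fE]].
have mf := measurable_int _ intf.
exists (fine \o f); split.
- exact: measurableT_comp.
- by move=> x; exact: fine_ge0.
- move=> B mB; rewrite -[RHS]/(nu B) fE//.
  rewrite [RHS]ge0_integral_pushforward//; last exact: measurable_funTS.
  by apply: eq_integral => x _ /=; rewrite fineK.
Qed.

End factored_condexp.

(** * Sub-sigma-algebras *)

Section sub_sigma_algebra.
Context {d : measure_display} {W : measurableType d} {R : realType}.
Variable F : set_system W.
Hypotheses (sF : sigma_algebra setT F) (FW : F `<=` measurable).

Lemma measurable_sub_sigmaE (A : set (g_sigma_algebraType F)) :
  measurable A = F A.
Proof. by rewrite /measurable/= sigma_algebra_id. Qed.

Lemma measurable_fun_sub_sigma_id :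
  measurable_fun setT (idfun : W -> g_sigma_algebraType F).
Proof. by move=> _ A; rewrite setTI preimage_id measurable_sub_sigmaE => /FW. Qed.

Lemma measurable_fun_sub_sigmaP d' (S : measurableType d') (f : W -> S) :
  measurable_fun setT (f : g_sigma_algebraType F -> S) <->
  (forall B, measurable B -> F (f @^-1` B)).
Proof.
split=> [mf B mB|mf _ B mB].
  by have := mf measurableT B mB; rewrite setTI measurable_sub_sigmaE.
by rewrite setTI measurable_sub_sigmaE; exact: mf.
Qed.

Lemma measurable_fun_sub_sigmaW d' (S : measurableType d') (f : W -> S) :
  measurable_fun setT (f : g_sigma_algebraType F -> S) -> measurable_fun setT f.
Proof. by move=> /measurable_fun_sub_sigmaP mf _ B /mf/FW; rewrite setTI. Qed.

End sub_sigma_algebra.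

(** When moreover [Y1] is [F]-measurable and integrable, it is a version of the
    conditional expectation of [Y2] given [F]. *)
Definition agree_on d (W : measurableType d) (R : realType)
    (P : {measure set W -> \bar R}) (F : set_system W) (Y1 Y2 : W -> R) :=
  forall A, F A -> (\int[P]_(x in A) (Y1 x)%:E = \int[P]_(x in A) (Y2 x)%:E)%E.

(** * Conditional independence of past and future *)

Section conditional_independence.
Context {d dS dV : measure_display} {W : measurableType d}
  {S : measurableType dS} {V : measurableType dV} {R : realType}.
Variables (P : probability W R) (F : set_system W) (X : W -> S) (U : W -> V).
Hypotheses (mX : measurable_fun setT X) (mU : measurable_fun setT U).
Hypothesis FW : F `<=` measurable.
Hypothesis FX : forall B, measurable B -> F (X @^-1` B).

Let mulC_int (D : set W) (f g : W -> R) :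
  (\int[P]_(x in D) (f x * g x)%:E = \int[P]_(x in D) (g x * f x)%:E)%E.
Proof. by apply: eq_integral => x _; rewrite mulrC. Qed.

Let int_indicr (D A : set W) (H : W -> R) :
  (\int[P]_(x in D `&` A) (H x)%:E = \int[P]_(x in D) (H x * \1_A x)%:E)%E.
Proof. by rewrite -integral_mul_indic mulC_int. Qed.

(** Let [A] be an event of the past and [k(X)] its conditional probability given
    [X]. By the hypothesis on indicators and two uses of [pull_out] along [X],
    [\1_A] and [k(X)] have the same mass on every future event, so [pull_out]
    along [U] gives [E(s(U) ; A) = E(k(X) s(U))] for all [s >= 0] at once. The
    right-hand side no longer sees the past, and [s(U)] can be replaced there by
    its conditional expectation [h(X)]; then [k(X)] is turned back into [\1_A].
    This avoids truncating [s] and taking limits of conditional expectations. *)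
Lemma indic_condexp_integrable :
  (forall E, measurable E -> exists e : S -> R,
    [/\ measurable_fun setT e, forall x, 0 <= e x &
        agree_on P F (e \o X) (\1_E \o U)]) ->
  forall s : V -> R, measurable_fun setT s -> (forall v, 0 <= s v) ->
    P.-integrable setT (EFin \o (s \o U)) ->
  exists h : S -> R, [/\ measurable_fun setT h, forall x, 0 <= h x &
    agree_on P F (h \o X) (s \o U)].
Proof.
move=> indF s ms s0 ints.
have [h [mh h0 hE]] := factored_condexp mX (fun x => s0 (U x)) ints.
exists h; split=> // A FA; have mA := FW FA.
have ind0 (B : set W) x : 0 <= \1_B x :> R by [].
have intA : P.-integrable setT (EFin \o (\1_A : W -> R)).
  exact: integrable_indic.
have [k [mk k0 kE]] := factored_condexp mX (ind0 A) intA.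
have kX0 x : 0 <= (k \o X) x by exact: k0.
have hX0 x : 0 <= (h \o X) x by exact: h0.
have sU0 x : 0 <= (s \o U) x by exact: s0.
have mkX : measurable_fun setT (k \o X) by exact: measurableT_comp.
have msU : measurable_fun setT (s \o U) by exact: measurableT_comp.
have mhX : measurable_fun setT (h \o X) by exact: measurableT_comp.
have kU E : measurable E -> (\int[P]_(x in U @^-1` E) (\1_A x)%:E =
    \int[P]_(x in U @^-1` E) (k (X x))%:E)%E.
  move=> mE; have [e [me e0 eE]] := indF E mE.
  have eX0 x : 0 <= (e \o X) x by exact: e0.
  have meX : measurable_fun setT (e \o X) by exact: measurableT_comp.
  have mUE : measurable (U @^-1` E).
    by rewrite -[_ @^-1` _]setTI; exact: mU.
  have UE x : \1_E (U x) = \1_(U @^-1` E) x :> R by rewrite !indicE.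
  have mIE : measurable_fun setT (\1_(U @^-1` E) : W -> R) by [].
  transitivity (\int[P]_(x in A) (\1_E (U x))%:E)%E.
    rewrite -[A]setTI -[U @^-1` E]setTI !int_indicr setTI.
    by apply: eq_integral => x _; rewrite UE mulrC.
  rewrite -(eE A FA).
  transitivity (\int[P]_x (e (X x) * \1_A x)%:E)%E.
    by rewrite -int_indicr setTI.
  transitivity (\int[P]_x (e (X x) * k (X x))%:E)%E.
    by apply: (pull_out (H2 := k \o X) mX) => // B mB; rewrite kE.
  rewrite mulC_int.
  transitivity (\int[P]_x (k (X x) * \1_(U @^-1` E) x)%:E)%E.
    apply: (pull_out (H1 := e \o X) mX) => // B mB.
    by rewrite (eE _ (FX mB)); apply: eq_integral => x _; rewrite /= UE.
  by rewrite -int_indicr setTI.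
transitivity (\int[P]_x (h (X x) * \1_A x)%:E)%E.
  by rewrite -int_indicr setTI.
transitivity (\int[P]_x (h (X x) * k (X x))%:E)%E.
  by apply: (pull_out (H2 := k \o X) mX) => // B mB; rewrite kE.
rewrite mulC_int.
transitivity (\int[P]_x (k (X x) * s (U x))%:E)%E.
  exact: (pull_out (H1 := h \o X) (H2 := s \o U) mX).
rewrite mulC_int.
transitivity (\int[P]_x (s (U x) * \1_A x)%:E)%E.
  by apply: (pull_out (H1 := k \o X) mU) => // E mE; rewrite kU.
by rewrite -int_indicr setTI.
Qed.

End conditional_independence.

(** * Change of measure: Bayes' formula *)

Section bayes.
Context {d dS dV : measure_display} {W : measurableType d}
  {S : measurableType dS} {V : measurableType dV} {R : realType}.
Variables (P Q : probability W R) (F : set_system W) (X : W -> S) (U : W -> V).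
Hypotheses (mX : measurable_fun setT X) (mU : measurable_fun setT U).
Hypotheses (sF : sigma_algebra setT F) (FW : F `<=` measurable).
Hypothesis FX : forall B, measurable B -> F (X @^-1` B).
Hypothesis condP : forall s : V -> R,
  measurable_fun setT s -> (forall v, 0 <= s v) ->
  P.-integrable setT (EFin \o (s \o U)) ->
  exists h : S -> R, [/\ measurable_fun setT h, forall x, 0 <= h x &
    agree_on P F (h \o X) (s \o U)].
Variables (K : W -> R) (b : V -> R).
Hypotheses (mK : measurable_fun setT (K : g_sigma_algebraType F -> R))
  (K0 : forall w, 0 <= K w).
Hypotheses (mb : measurable_fun setT b) (b0 : forall v, 0 <= b v)
  (intb : P.-integrable setT (EFin \o (b \o U))).
Hypothesis QE : forall A, measurable A ->
  Q A = (\int[P]_(x in A) (K x * b (U x))%:E)%E.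

Let mKW : measurable_fun setT K := measurable_fun_sub_sigmaW sF FW mK.

Let mbU : measurable_fun setT (b \o U) := measurableT_comp mb mU.

Lemma integral_change_density (Y : W -> R) (A : set W) : measurable A ->
  measurable_fun setT Y -> (forall w, 0 <= Y w) ->
  (\int[Q]_(x in A) (Y x)%:E = \int[P]_x ((\1_A x * K x * Y x) * b (U x))%:E)%E.
Proof.
move=> mA mY Y0.
have mKb : measurable_fun setT (fun x => K x * b (U x)).
  exact: measurable_funM.
transitivity (\int[Q]_x ((\1_A x * Y x) * 1)%:E)%E.
  rewrite -[A in LHS]setTI -integral_mul_indic.
  by under [RHS]eq_integral do rewrite mulr1.
transitivity (\int[P]_x ((\1_A x * Y x) * (K x * b (U x)))%:E)%E; last first.
  by apply: eq_integral => x _; congr EFin; rewrite !mulrA (mulrAC _ (Y x)).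
apply: (pull_out (X := idfun) (H1 := cst 1) (s := fun x => \1_A x * Y x)) => //.
- exact: measurable_id.
- by move=> x /=; rewrite mulr_ge0.
- by move=> B mB; rewrite preimage_id -QE// -[RHS]mul1e -(integral_cst Q mB).
- exact: measurable_funM.
- by move=> x /=; rewrite mulr_ge0.
Qed.

(** Let [u(X)] and [v(X)] be the conditional expectations of [b(U)] and of
    [y(U) b(U)] given the past under [P]. The quotient [v / u] works: against
    the density [K b(U)], the past-measurable factors [\1_A], [K] and
    [v(X) / u(X)] leave [b(U)] to be replaced by [u(X)], which cancels the
    denominator. *)
Lemma bayes_condexp (M : R) (y : V -> R) : measurable_fun setT y ->
  (forall v, 0 <= y v <= M) ->
  exists z : S -> R, [/\ measurable_fun setT z, forall x, 0 <= z x &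
    agree_on Q F (z \o X) (y \o U)].
Proof.
move=> my yM; have y0 v : 0 <= y v by have /andP[] := yM v.
have M0 : 0 <= M by have /andP[+ +] := yM point; exact: le_trans.
have myb : measurable_fun setT (y \* b) by exact: measurable_funM.
have yb0 v : 0 <= (y \* b) v by rewrite mulr_ge0.
have mybU : measurable_fun setT ((y \* b) \o U) by exact: measurableT_comp.
have yb_le v : (y \* b) v <= M * b v.
  by rewrite ler_wpM2r//; have /andP[] := yM v.
have intMb : P.-integrable setT (EFin \o (fun x => M * b (U x))).
  under [X in _.-integrable _ X]eq_fun do rewrite /= EFinM.
  exact: integrableZl.
have intyb : P.-integrable setT (EFin \o ((y \* b) \o U)).
  apply: le_integrable intMb => //; first exact/measurable_EFinP.
  move=> x _ /=; rewrite lee_fin !ger0_norm//; first exact: yb_le.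
    exact: mulr_ge0.
  exact: (yb0 (U x)).
have [u [mu u0 uE]] := condP mb b0 intb.
have [v [mv v0 vE]] := condP myb yb0 intyb.
have muX : measurable_fun setT (u \o X) by exact: measurableT_comp.
have mvX : measurable_fun setT (v \o X) by exact: measurableT_comp.
have uX0 x : 0 <= (u \o X) x by exact: u0.
have vX0 x : 0 <= (v \o X) x by exact: v0.
have mz : measurable_fun setT (fun x => v x / u x).
  (* On non-negative reals inversion is a real power, which is measurable. *)
  under eq_fun do rewrite -powR_inv1//.
  apply: measurable_funM => //.
  exact: (measurableT_comp (measurable_powR _) mu).
have z0 x : 0 <= v x / u x by rewrite divr_ge0.
exists (fun x => v x / u x); split=> // A FA; have mA := FW FA.
have mzX : measurable_fun setT (fun x => v (X x) / u (X x)).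
  exact: (measurableT_comp mz mX).
have FidW := measurable_fun_sub_sigma_id sF FW.
have mIA : measurable_fun setT (\1_A : g_sigma_algebraType F -> R).
  by apply: measurable_indic; rewrite measurable_sub_sigmaE.
have mXF : measurable_fun setT (X : g_sigma_algebraType F -> S).
  exact/measurable_fun_sub_sigmaP.
have F_pull (s H1 H2 : W -> R) : agree_on P F H1 H2 ->
    measurable_fun setT (s : g_sigma_algebraType F -> R) ->
    (forall x, 0 <= s x) ->
    measurable_fun setT H1 -> (forall x, 0 <= H1 x) ->
    measurable_fun setT H2 -> (forall x, 0 <= H2 x) ->
    (\int[P]_x (s x * H1 x)%:E = \int[P]_x (s x * H2 x)%:E)%E.
  move=> H12 ms s0 mH1 H10 mH2 H20.
  apply: (pull_out (X := idfun : W -> g_sigma_algebraType F) (s := s)) => //.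
  by move=> B; rewrite measurable_sub_sigmaE// preimage_id; exact: H12.
have myU : measurable_fun setT (y \o U) by exact: measurableT_comp.
rewrite !integral_change_density//; last 2 first.
- by move=> x; exact: y0.
- by move=> x; exact: z0.
transitivity (\int[P]_x ((\1_A x * K x * (v (X x) / u (X x))) * u (X x))%:E)%E.
  apply: F_pull => //.
  - by move=> B FB; rewrite (uE _ FB).
  - apply: measurable_funM; first exact: measurable_funM.
    exact: (measurableT_comp mz mXF).
  - by move=> x; apply: mulr_ge0; [exact: mulr_ge0|exact: z0].
transitivity (\int[P]_x ((\1_A x * K x) * v (X x))%:E)%E; last first.
  transitivity (\int[P]_x ((\1_A x * K x) * (y \* b) (U x))%:E)%E.
    apply: F_pull => //; first exact: measurable_funM.
    by move=> x /=; rewrite !mulr_ge0.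
  by apply: eq_integral => x _; rewrite /= !mulrA.
(* The quotient is 0 where the denominator vanishes; since y <= M, the
   conditional expectation v of y b is at most M u and vanishes there too. *)
have v_eq0 : {ae P, forall x, u (X x) = 0 -> v (X x) = 0}.
  pose N := X @^-1` (u @^-1` [set 0]).
  have mN0 : measurable (u @^-1` [set 0]).
    by rewrite -[_ @^-1` _]setTI; exact: mu.
  have FN : F N by exact: FX.
  have mN : measurable N by exact: FW.
  have : (\int[P]_(x in N) `|(v (X x))%:E| = 0)%E.
    apply/eqP; rewrite eq_le integral_ge0// andbT.
    under eq_integral do rewrite gee0_abs ?lee_fin//.
    rewrite (vE _ FN).
    apply: (@le_trans _ _ (\int[P]_(x in N) (M * b (U x))%:E)%E).
      apply: ge0_le_integral => //.
      - by move=> x _; rewrite lee_fin; exact: yb0.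
      - exact/measurable_funTS/measurable_EFinP.
      - by apply/measurable_funTS/measurable_EFinP; exact: measurable_funM.
      - by move=> x _; rewrite lee_fin; exact: yb_le.
    under eq_integral do rewrite EFinM.
    rewrite ge0_integralZl_EFin//; last 2 first.
    - by move=> x _; rewrite lee_fin.
    - exact/measurable_funTS/measurable_EFinP.
    rewrite -(uE _ FN) integral0_eq ?mule0// => x Nx /=.
    by rewrite Nx.
  move/ae_eq_integral_abs => /(_ mN).
  have mvN : measurable_fun N (fun x => (v (X x))%:E).
    exact/measurable_funTS/measurable_EFinP.
  move=> /(_ mvN); apply: filterS => x /= + ux0 => /(_ ux0).
  by move=> [].
have mIK : measurable_fun setT (\1_A \* K) by exact: measurable_funM.
have IK0 x : 0 <= \1_A x * K x by rewrite mulr_ge0.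
apply: ge0_ae_eq_integral => //.
- apply/measurable_EFinP; apply: (measurable_funM (f := fun x => _ * _)) => //.
  exact: measurable_funM.
- by apply/measurable_EFinP; exact: measurable_funM.
- by move=> x _; rewrite lee_fin mulr_ge0// mulr_ge0//; exact: z0.
- by move=> x _; rewrite lee_fin; apply: mulr_ge0.
move: v_eq0; apply: filterS => x vx _; congr EFin; rewrite -mulrA; congr (_ * _).
have [ux0|ux0] := eqVneq (u (X x)) 0; first by rewrite vx// ux0 mulr0.
by rewrite divfK.
Qed.

End bayes.

(** * Versions of a conditional expectation *)

Section versions.
Context {d : measure_display} {W : measurableType d} {R : realType}.
Variables (P : probability W R) (F : set_system W).
Hypotheses (sF : sigma_algebra setT F) (FW : F `<=` measurable).
Implicit Types Y Z : W -> R.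

(** The uniqueness of densities is applied on the measurable space [(W, F)], to
    the image of [P] under the identity map. *)
Lemma is_condexp_unique Y Z1 Z2 :
  is_condexp P F Y Z1 -> is_condexp P F Y Z2 -> {ae P, forall w, Z1 w = Z2 w}.
Proof.
move=> [/(measurable_fun_sub_sigmaP sF) mZ1 iZ1 eZ1].
move=> [/(measurable_fun_sub_sigmaP sF) mZ2 iZ2 eZ2].
have mid := measurable_fun_sub_sigma_id sF FW.
have mE (Z : g_sigma_algebraType F -> R) :
  measurable_fun setT Z -> measurable_fun setT (EFin \o Z) by move/measurable_EFinP.
have iS Z A : P.-integrable setT (EFin \o Z) -> F A -> P.-integrable A (EFin \o Z).
  by move=> iZ /FW mA; apply: integrableS iZ.
have [N [mN N0 subN]] : ae_eq (pushforward P (idfun : W -> g_sigma_algebraType F))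
    setT (EFin \o Z1) (EFin \o Z2).
  move=> mid'; apply: integral_ae_eq => //.
  - by apply: integrable_pushforward => //; exact: mE.
  - exact: mE.
  - move=> A _; rewrite measurable_sub_sigmaE// => FA.
    rewrite !(integral_pushforward mid); first by rewrite preimage_id eZ1// eZ2.
    + exact: mE.
    + by rewrite preimage_id; exact: iS.
    + by rewrite measurable_sub_sigmaE.
    + exact: mE.
    + by rewrite preimage_id; exact: iS.
    + by rewrite measurable_sub_sigmaE.
exists N; split => //; first by apply: FW; rewrite -measurable_sub_sigmaE.
by move=> w /= nZ; apply: subN => /= /(_ Logic.I) [].
Qed.

Lemma condexp_ae_eq Y Z :
  is_condexp P F Y Z -> {ae P, forall w, condexp P F Y w = Z w}.
Proof.
move=> YZ; apply: (is_condexp_unique (Y := Y)) => //; rewrite /condexp.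
exact: (@xgetPex _ (fun=> 0) [set Z | is_condexp P F Y Z] (ex_intro _ Z YZ)).
Qed.

Lemma agree_on_is_condexp Y Z : (forall w, 0 <= Y w) -> (forall w, 0 <= Z w) ->
  P.-integrable setT (EFin \o Y) -> (forall B, measurable B -> F (Z @^-1` B)) ->
  agree_on P F Z Y -> is_condexp P F Y Z.
Proof.
move=> Y0 Z0 /integrableP[_ iY] FZ ZY; split=> //.
have /measurable_EFinP mZ : measurable_fun setT Z.
  by apply: (measurable_fun_sub_sigmaW sF FW); exact/measurable_fun_sub_sigmaP.
apply/integrableP; split => //; move: iY.
under eq_integral do rewrite /= ger0_norm//.
under [X in _ -> (X < _)%E]eq_integral do rewrite /= ger0_norm//.
rewrite -ZY//; have [F0 FC _] := sF.
by rewrite -[setT]setD0; exact: FC.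
Qed.

End versions.

Section markov_factor.
Context {d dS dV : measure_display} {W : measurableType d}
  {S : measurableType dS} {V : measurableType dV} {R : realType}.
Variables (P : probability W R) (F : set_system W) (X : W -> S) (U : W -> V).
Hypotheses (mX : measurable_fun setT X) (mU : measurable_fun setT U).
Hypotheses (sF : sigma_algebra setT F) (FW : F `<=` measurable).
Hypothesis FX : forall B, measurable B -> F (X @^-1` B).

Local Notation sX := (g_sigma_algebra_preimage X).

Let sX_sigma : sigma_algebra setT sX.
Proof. exact: sigma_algebra_preimage (sigma_algebra_measurable S). Qed.

Let sXF : sX `<=` F.
Proof. by move=> _ [B mB <-]; rewrite setTI; exact: FX. Qed.

Let sXW : sX `<=` measurable := subset_trans sXF FW.

Let sX_comp (z : S -> R) : measurable_fun setT z ->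
  forall B, measurable B -> sX ((z \o X) @^-1` B).
Proof.
move=> mz B mB; exists (z @^-1` B); last by rewrite setTI.
by rewrite -[_ @^-1` _]setTI; exact: mz.
Qed.

(** [condexp] is an arbitrary version when one exists and 0 otherwise, so the
    equation in the hypothesis carries information only because both
    conditional expectations exist, by [factored_condexp]. *)
Lemma markov_indic (E : set V) : measurable E ->
  {ae P, forall w, condexp P F (\1_E \o U) w = condexp P sX (\1_E \o U) w} ->
  exists e : S -> R, [/\ measurable_fun setT e, forall x, 0 <= e x &
        agree_on P F (e \o X) (\1_E \o U)].
Proof.
move=> mE markov; pose Y : W -> R := \1_E \o U.
have mY : measurable_fun setT Y by exact: measurableT_comp.
have Y0 w : 0 <= Y w by rewrite /Y/=.
have iY : P.-integrable setT (EFin \o Y).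
  rewrite (_ : Y = \1_(U @^-1` E)); last first.
    by apply/funext => w; rewrite /Y/= !indicE.
  apply: integrable_indic => //.
  by rewrite -[_ @^-1` _]setTI; exact: mU.
have [e [me e0 eE]] := factored_condexp mX Y0 iY.
have eXE : is_condexp P sX Y (e \o X).
  apply: agree_on_is_condexp => //; first by move=> w; exact: e0.
    exact: sX_comp.
  by move=> _ [B mB <-]; rewrite setTI; exact: eE.
have [y [my y0 yE]] := factored_condexp (measurable_fun_sub_sigma_id sF FW) Y0 iY.
have yF : is_condexp P F Y y.
  apply: agree_on_is_condexp => //; first exact/measurable_fun_sub_sigmaP.
  by move=> A FA; apply: yE; rewrite measurable_sub_sigmaE.
exists e; split=> // A FA; have mA := FW FA.
have [_ _ <-] := yF => //.
have myW := measurable_fun_sub_sigmaW sF FW my.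
apply: ge0_ae_eq_integral => //.
- exact/measurable_funTS/measurable_EFinP/measurableT_comp.
- exact/measurable_funTS/measurable_EFinP.
- by move=> w _; rewrite lee_fin; exact: e0.
- by move=> w _; rewrite lee_fin; exact: y0.
have ae1 := condexp_ae_eq sX_sigma sXW eXE.
have ae2 := condexp_ae_eq sF FW yF.
move: ae1 ae2 markov; apply: filterS3 => w h1 h2 h3 _.
by congr EFin; rewrite -h1 -h2 h3.
Qed.

(** A function of [X] that is a version of the conditional expectation given [F]
    is also a version given the smaller sigma-algebra of [X], and versions are
    almost surely unique. *)
Lemma condexp_factored (f : V -> R) : measurable_fun setT f -> bounded_fun f ->
  (forall (M : R) (y : V -> R), measurable_fun setT y ->
    (forall v, 0 <= y v <= M) ->
    exists z : S -> R, [/\ measurable_fun setT z, forall x, 0 <= z x &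
      agree_on P F (z \o X) (y \o U)]) ->
  {ae P, forall w, condexp P F (f \o U) w = condexp P sX (f \o U) w}.
Proof.
move=> mf [M0 [_ bf]] factor.
(* f is shifted by a bound M to make it non-negative. *)
pose M := Num.max 0 (M0 + 1).
have fM v : `|f v| <= M.
  by apply: (le_trans (bf (M0 + 1) _ v _)) => //; rewrite ?ltrDl// le_max lexx orbT.
have [z [mz z0 zE]] : exists z : S -> R, [/\ measurable_fun setT z,
    forall x, 0 <= z x & agree_on P F (z \o X) ((fun v => f v + M) \o U)].
  apply: (factor (M + M)); first exact: measurable_funD.
  by move=> v; have := fM v; rewrite ler_norml -lerBlDr sub0r lerD2r.
have mfU : measurable_fun setT (f \o U) by exact: measurableT_comp.
have iM : P.-integrable setT (EFin \o cst M).
  exact: finite_measure_integrable_cst.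
have ifU : P.-integrable setT (EFin \o (f \o U)).
  apply: le_integrable iM => //; first exact/measurable_EFinP.
  by move=> w _ /=; rewrite lee_fin (le_trans (fM _))// ler_norm.
have ifM : P.-integrable setT (EFin \o ((fun v => f v + M) \o U)).
  by under [X in _.-integrable _ X]eq_fun do rewrite /= EFinD; exact: integrableD.
have version (G : set_system W) : sigma_algebra setT G -> sX `<=` G -> G `<=` F ->
    is_condexp P G (f \o U) (fun w => z (X w) - M).
  move=> sG XG GF; have GW := subset_trans GF FW.
  have [_ iz _] : is_condexp P G ((fun v => f v + M) \o U) (z \o X).
    apply: agree_on_is_condexp => //.
    - move=> w /=; have := fM (U w).
      by rewrite ler_norml -lerBlDr sub0r => /andP[].
    - by move=> w; exact: z0.
    - by move=> B mB; apply: XG; exact: sX_comp.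
    - by move=> A /GF; exact: zE.
  split.
  - move=> B mB; apply: XG; apply: (sX_comp (z := fun x => z x - M)) => //.
    exact: measurable_funB.
  - by under [X in _.-integrable _ X]eq_fun do rewrite EFinB; exact: integrableB.
  - move=> A GA; have mA := GW _ GA.
    have iA g : P.-integrable setT (EFin \o g) -> P.-integrable A (EFin \o g).
      by move=> ig; apply: integrableS ig.
    under eq_integral do rewrite EFinB.
    rewrite integralB//; [|exact: iA..].
    rewrite (zE _ (GF _ GA)).
    under eq_integral do rewrite /= EFinD.
    rewrite integralD//; [|exact: iA..].
    by rewrite addeK// integrable_fin_num//; exact: iA.
have aeF := condexp_ae_eq sF FW (version F sF sXF (fun A FA => FA)).
have aeX := condexp_ae_eq sX_sigma sXW (version sX sX_sigma (fun A FA => FA) sXF).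
by move: aeF aeX; apply: filterS2 => w -> ->.
Qed.

End markov_factor.

(** * Joint measurability of right-continuous processes *)

Lemma closed_borel (E : topologicalType) (C : set E) :
  closed C -> <<s open >> C.
Proof.
move=> cC; rewrite -[C]setCK -setTD; apply: sigma_algebraCD.
by apply: sub_sigma_algebra; exact: closed_openC.
Qed.

Section limit_of_measurable.
Context {d : measure_display} {T : measurableType d} {R : realType}
  {E : pseudoMetricType R}.

(** The complement of an open neighbourhood, of radius [1 / (m + 1)], of the
    complement of [O]; interiors are taken because balls of a pseudometric space
    need not be open. *)
Let core (O : set E) (m : nat) : set E :=
  ~` \bigcup_(z in ~` O) (ball z m.+1%:R^-1)^°.

Let closed_core O m : closed (core O m).
Proof.
by apply: open_closedC; apply: bigcup_open => z _; exact: open_interior.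
Qed.

Let core_cvg (O : set E) (y_ : nat -> E) (y : E) : open O -> y_ @ \oo --> y ->
  O y <-> exists m N, forall n, (N <= n)%N -> core O m (y_ n).
Proof.
move=> oO y_y; split=> [Oy|[m [N coreN]]].
- have : nbhs y O by exact: open_nbhs_nbhs.
  move=> /nbhs_ballP[e /= e0 yeO].
  have e20 : 0 < e / 2 by rewrite divr_gt0.
  have [m] := ltr_add_invr e20; rewrite add0r => me.
  have /y_y[N _ yN] : nbhs y (ball y (e / 2)) by apply: nbhsx_ballx; rewrite divr_gt0.
  exists m, N => n Nn [z nOz /interior_subset zy]; apply: nOz; apply: yeO.
  have := ball_triangle (yN n Nn) (ball_sym (le_ball (ltW me) zy)).
  by rewrite -splitr.
- apply: contrapT => nOy.
  have /y_y[N' _ yN'] : nbhs y (ball y m.+1%:R^-1)^°.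
    by apply: nbhs_interior; exact: nbhsx_ballx.
  have := coreN (maxn N N') (leq_maxl _ _); apply; exists y => //.
  by apply: yN'; exact: leq_maxr.
Qed.

(** Closed sets [core G m] exhaust the open set [G], and a limit lies in [G] if
    and only if the sequence eventually stays in one of them: the preimage of
    [G] is thus a countable combination of preimages of closed sets. *)
Lemma measurable_preimage_open_cvg (D : set T) (f_ : nat -> T -> E)
    (f : T -> E) :
  (forall n (C : set E), closed C -> measurable (D `&` f_ n @^-1` C)) ->
  (forall x, D x -> f_ n x @[n --> \oo] --> f x) ->
  forall G, open G -> measurable (D `&` f @^-1` G).
Proof.
move=> mf_ f_f G oG.
rewrite (_ : _ `&` _ =
    \bigcup_m \bigcup_N \bigcap_(n in [set n | (N <= n)%N])
      (D `&` f_ n @^-1` core G m)).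
  apply: bigcupT_measurable => m; apply: bigcupT_measurable => N.
  apply: bigcap_measurable => [|n _]; first by exists N => /=.
  by apply: mf_; exact: closed_core.
apply/seteqP; split=> x.
- move=> [Dx /(core_cvg oG (f_f x Dx))[m [N coreN]]].
  by exists m => //; exists N => // n /= Nn; split=> //; exact: coreN.
- move=> [m _ [N _ coreN]]; have [Dx _] := coreN N (leqnn N).
  split=> //; apply/(core_cvg oG (f_f x Dx)).
  by exists m, N => n Nn; have [] := coreN n Nn.
Qed.

End limit_of_measurable.

Section next_time.
Context {R : realType}.
Variables (a b : R).
Implicit Types (r : R) (n : nat).

Definition grid n k : R := Num.min b (a + k.+1%:R / n.+1%:R).

(** The first point of the grid of mesh [1 / (n + 1)] strictly after [r], capped
    at [b]. It approaches [r] from the right, as right continuity requires, and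
    never leaves [[a, b]]: no value of the process after [b] is consulted. *)
Definition next_time n r : R := grid n (Num.truncn ((r - a) * n.+1%:R)).

Lemma grid_itv n k : a <= b -> a <= grid n k <= b.
Proof.
move=> ab; rewrite /grid le_min ab ge_min lexx/= andbT.
by rewrite lerDl divr_ge0.
Qed.

Lemma next_time_itv n r : a <= r <= b ->
  [/\ r <= next_time n r, next_time n r <= r + n.+1%:R^-1 &
      r < b -> r < next_time n r].
Proof.
move=> /andP[ar rb]; have n0 : 0 < n.+1%:R :> R by [].
have : 0 <= (r - a) * n.+1%:R by rewrite mulr_ge0// subr_ge0.
move=> /truncn_itv/andP[lo hi].
have {}lo : (Num.truncn ((r - a) * n.+1%:R))%:R / n.+1%:R <= r - a.
  by rewrite ler_pdivrMr.
have {}hi : r - a < (Num.truncn ((r - a) * n.+1%:R)).+1%:R / n.+1%:R.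
  by rewrite ltr_pdivlMr.
have {}hi : r < a + (Num.truncn ((r - a) * n.+1%:R)).+1%:R / n.+1%:R.
  by rewrite -ltrBlDl.
split; rewrite /next_time /grid.
- by rewrite le_min rb ltW.
- rewrite ge_min; apply/orP; right.
  rewrite -[X in X%:R / _]addn1 natrD mulrDl mul1r addrA lerD2r.
  by rewrite -lerBrDl.
- by move=> {}rb; rewrite lt_min rb.
Qed.

Lemma next_time_cvg r : a <= r <= b -> next_time n r @[n --> \oo] --> r.
Proof.
move=> arb.
apply: (@squeeze_cvgr _ _ _ _ (cst r) (fun n => r + n.+1%:R^-1)).
- by apply: nearW => n; have [-> ->] := next_time_itv n arb.
- exact: cvg_cst.
- rewrite -[X in _ --> X]addr0; apply: cvgD; first exact: cvg_cst.
  exact: cvg_harmonic.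
Qed.

Lemma right_continuous_next_time (E : topologicalType) (x : R -> E) r :
  (forall r, a <= r < b -> x u @[u --> r^'+] --> x r) ->
  a <= r <= b -> x (next_time n r) @[n --> \oo] --> x r.
Proof.
move=> rcx arb; have /andP[ar] := arb; rewrite le_eqVlt => /predU1P[rb|rb].
- rewrite (_ : (fun n => _) = cst (x r)); first exact: cvg_cst.
  apply/funext => n; congr x; apply/eqP; rewrite eq_le.
  have [-> _ _] := next_time_itv n arb; rewrite andbT rb.
  by rewrite /next_time /grid ge_min lexx.
- have /rcx : a <= r < b by rewrite ar.
  apply: cvg_comp => A [e /= e0 eA].
  have [N _ Ne] := next_time_cvg arb (nbhsx_ballx r _ e0).
  exists N => // n Nn; apply: (eA _ (Ne n Nn)).
  by have [_ _ /(_ rb)] := next_time_itv n arb.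
Qed.

End next_time.

Section joint_measurability.
Context {R : realType} {d : nat} {dW : measure_display} {W : measurableType dW}.
Variables (a b : R) (X : R -> W -> 'rV[R]_d).
Hypothesis ab : a <= b.
Hypothesis mX : forall r, a <= r <= b ->
  measurable_fun setT (X r : W -> borel 'rV[R]_d).
Hypothesis rcX : forall w r, a <= r < b -> X u w @[u --> r^'+] --> X r w.

(** The process sampled at [next_time] takes countably many times as values, is
    constant in time between them, and converges to the process. The target
    carries the Borel sigma-algebra of the product topology; the sampled time is
    kept as the first component so that only sections of closed sets at fixed
    times occur. *)
Lemma measurable_time_path : measurable_fun (`[a, b] `*` [set: W])
  (fun z => (z.1, X z.1 z.2) : borel (R * 'rV[R]_d)%type).
Proof.
have mabW : measurable (`[a, b] `*` [set: W]) by exact: measurableX.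
apply: measurability; first by [].
move=> _ [G oG <-].
apply: (measurable_preimage_open_cvg (E := (R * 'rV[R]_d)%type) (f_ :=
  (fun n z => (next_time a b n z.1, X (next_time a b n z.1) z.2)))) => //.
- move=> n C cC.
  pose I k : set R := `[a, b] `&` `[a + k%:R / n.+1%:R, a + k.+1%:R / n.+1%:R[.
  pose A k : set W := X (grid a b n k) @^-1` [set x | C (grid a b n k, x)].
  have IE k r : I k r -> Num.truncn ((r - a) * n.+1%:R) = k.
    move=> [_ /=]; rewrite in_itv/= => /andP[lo hi]; apply: truncn_def.
    by rewrite -ler_pdivrMr// -ltr_pdivlMr// lerBrDl ltrBlDl lo.
  rewrite (_ : _ `&` _ = \bigcup_k (I k `*` A k)).
    apply: bigcupT_measurable => k; apply: measurableX.
      by apply: measurableI; exact: measurable_itv.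
    rewrite -[A k]setTI; apply: (mX (grid_itv n k ab)) => //.
    apply: closed_borel.
    apply: (@preimage_closed _ _ (fun x : 'rV[R]_d => (grid a b n k, x)) C) => // x _.
    apply: (@cvg_pair _ _ _ (nbhs x) (nbhs (grid a b n k)) (nbhs x) _ _ _
      (fun=> grid a b n k) id); [exact: cvg_cst|exact: cvg_id].
  apply/seteqP; split=> -[r w] /=.
  + move=> [[arb _] Crw]; exists (Num.truncn ((r - a) * n.+1%:R)) => //.
    split=> //; split=> //=; move: arb; rewrite !in_itv/= => /andP[ar _].
    have : 0 <= (r - a) * n.+1%:R by rewrite mulr_ge0// subr_ge0.
    move=> /truncn_itv; rewrite -ler_pdivrMr// -ltr_pdivlMr//.
    by rewrite lerBrDl ltrBlDl.
  + move=> [k _ [Ir Aw]]; split; first by split=> //; have [] := Ir.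
    by rewrite /next_time (IE k r Ir).
- move=> [r w] [/=]; rewrite in_itv/= => arb _.
  apply: (@cvg_pair _ _ _ \oo (nbhs r) (nbhs (X r w)) _ _ _
    (next_time a b ^~ r) (fun n => X (next_time a b n r) w)).
    exact: next_time_cvg.
  by apply: (@right_continuous_next_time _ a b _ (X ^~ w)) => //; exact: rcX.
Qed.

Variable f : R * 'rV[R]_d -> R.
Hypothesis mf : measurable_fun
  (`[a, b] `*` setT : set (borel (R * 'rV[R]_d)%type)) f.

Lemma measurable_along_path : measurable_fun (`[a, b] `*` [set: W])
  (fun z => f (z.1, X z.1 z.2)).
Proof.
pose Phi (z : R * W) : borel (R * 'rV[R]_d)%type := (z.1, X z.1 z.2).
apply: (measurable_comp (g := Phi) _ _ mf).
- apply: closed_borel.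
  rewrite (_ : _ `*` _ = fst @^-1` `[a, b]).
    apply: preimage_closed => [z _|]; first exact: cvg_fst.
    exact: interval_closed.
  by apply/seteqP; split=> z /= => [[]|].
- by move=> _ [[r w] [/= Dr _] <-].
- exact: measurable_time_path.
Qed.

Lemma measurable_path_section (w : W) :
  measurable_fun `[a, b] (fun r => f (r, X r w)).
Proof.
apply: (measurable_comp (g := pair^~ w) _ _ measurable_along_path).
- exact: measurableX.
- by move=> _ [r ? <-].
- exact: measurable_funTS.
Qed.

Lemma measurable_path_integral (D : set R) : measurable D -> D `<=` `[a, b] ->
  (forall r x, a <= r <= b -> 0 <= f (r, x)) ->
  measurable_fun [set: W]
    (fun w => \int[lebesgue_measure]_(r in D) (f (r, X r w))%:E)%E.
Proof.
move=> mD Dab f0.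
have mDW : measurable (D `*` [set: W]) by exact: measurableX.
pose h : R * W -> \bar R := (fun z => (f (z.1, X z.1 z.2))%:E) \_ (D `*` setT).
have mh : measurable_fun setT h.
  apply/(measurable_restrictT _ mDW)/measurable_EFinP.
  apply: measurable_funS measurable_along_path; first exact: measurableX.
  by move=> [r w] [/= Dr _]; split=> //; exact: Dab.
have h0 z : (0 <= h z)%E.
  rewrite /h patchE; case: ifPn => // /[!inE] -[Dz _].
  by rewrite lee_fin f0//; have := Dab _ Dz; rewrite /= in_itv.
have := measurable_fun_fubini_tonelli_G (m1 := lebesgue_measure) h mh h0.
congr (measurable_fun _ _); apply/funext => w.
rewrite /fubini_G [RHS]integral_mkcond; apply: eq_integral => r _.
rewrite /h !patchE; congr (if _ then _ else _).
by apply/idP/idP; rewrite !inE => // -[].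
Qed.

End joint_measurability.

(** * The path space and its filtration *)

Section cadlag_measurability.
Context {R : realType} {d : nat}.
Implicit Types a b r s t T : R.

Lemma coord_sigma_preimage a b s r (B : set (borel 'rV[R]_d)) : a <= r <= s ->
  measurable B -> coord_sigma s (@coord_at R d a b r @^-1` B).
Proof.
move=> ars mB; apply: sub_sigma_algebra; exists r; first by rewrite /= in_itv.
by exists B => //; rewrite setTI.
Qed.

Lemma measurable_coord a b r : a <= r <= b ->
  measurable_fun setT (@coord_at R d a b r).
Proof. by move=> arb _ B mB; rewrite setTI; exact: coord_sigma_preimage. Qed.

Lemma measurable_restr a b t (at_ : a <= t) : t <= b ->
  measurable_fun setT (@restr R d a b t at_).
Proof.
move=> tb; apply: measurability; first by [].
move=> _ [_ [r /= rtb [B mB <-]] <-]; rewrite !setTI.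
move: rtb; rewrite in_itv/= => /andP[tr rb].
rewrite (_ : _ @^-1` _ = coord_at r @^-1` B).
  by apply: coord_sigma_preimage => //; rewrite rb (le_trans at_).
by apply/seteqP; split=> w; rewrite /= /coord_at/= tr.
Qed.

Lemma coord_sigmaS a b s t : s <= t ->
  (coord_sigma s : set_system (@cadlag R d a b)) `<=` coord_sigma t.
Proof.
move=> st; apply: sub_sigma_algebra2 => A [r /= ars Ar]; exists r => //=.
by move: ars; rewrite !in_itv/= => /andP[-> /le_trans->].
Qed.

Lemma filtr_sigma_algebra T t : sigma_algebra setT (@filtr R d T t).
Proof.
rewrite /filtr; case: ifPn => _; last exact: sigma_algebra_measurable.
split.
- by move=> s _; exact: coord_sigma0.
- by move=> A FA s sT; rewrite setTD; apply: coord_sigmaC; exact: FA.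
- by move=> A FA s sT; apply: coord_sigma_bigcup => i; exact: FA.
Qed.

Lemma filtr_measurable T t : @filtr R d T t `<=` measurable.
Proof.
rewrite /filtr; case: ifPn => [tT A|_]; last exact: subset_refl.
by apply; rewrite /= in_itv/= tT lexx.
Qed.

(** In particular the part of the weight that depends on the path up to time [t]
    is measurable for the right-continuous filtration at time [t]. *)
Lemma coord_sigma_filtr T t : t <= T -> coord_sigma t `<=` @filtr R d T t.
Proof.
move=> tT A tA; rewrite /filtr; case: ifPn => _.
  move=> s; rewrite /= in_itv/= => /andP[ts _].
  exact: (coord_sigmaS (ltW ts)).
exact: (coord_sigmaS tT).
Qed.

Lemma filtr_coord T t (B : set (borel 'rV[R]_d)) : 0 <= t <= T ->
  measurable B -> filtr t (@coord_at R d 0 T t @^-1` B).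
Proof.
move=> /andP[t0 tT] mB; apply: coord_sigma_filtr => //.
by apply: coord_sigma_preimage => //; rewrite t0 lexx.
Qed.

End cadlag_measurability.

(** * The Feynman-Kac weight *)

Lemma measurable_fk_weight (R : realType) (d : nat) (T : R)
    (f : R * 'rV[R]_d -> R) (g : 'rV[R]_d -> R) : 0 <= T ->
  measurable_fun
    (`[0, T] `*` setT : set (borel (R * 'rV[R]_d)%type)) f ->
  (forall (r : R) (x : 'rV[R]_d), 0 <= r <= T -> 0 <= f (r, x)) ->
  measurable_fun [set: borel 'rV[R]_d] g ->
  measurable_fun setT (@fk_weight R d T f g).
Proof.
move=> T0 mf f0 mg; apply: measurableT_comp => //; apply: measurable_funB.
  apply: measurableT_comp => //; apply: (measurableT_comp (f := fine)) => //.
  apply: (@measurable_path_integral _ _ _ _ 0 T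
    (fun r (x : cadlag 0 T) => x r)) => //.
  - by move=> r rt; exact: measurable_coord.
  - by move=> x r rt; have [xr _] := path_of_cadlag x; exact: xr.
apply: (measurableT_comp mg); apply: measurable_coord.
by rewrite T0 lexx.
Qed.

Section feynman_kac_density.
Context {R : realType} {d : nat} {T t : R}.
Hypotheses (t0 : 0 <= t) (tT : t <= T).
Variables (f : R * 'rV[R]_d -> R) (g : 'rV[R]_d -> R).
Hypothesis mf : measurable_fun
  (`[0, T] `*` setT : set (borel (R * 'rV[R]_d)%type)) f.
Hypothesis f0 : forall (r : R) (x : 'rV[R]_d), 0 <= r <= T -> 0 <= f (r, x).
Hypothesis mg : measurable_fun [set: borel 'rV[R]_d] g.

Local Notation leb := lebesgue_measure.

Definition past_weight (w : @cadlag R d 0 T) : R :=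
  expR (- \int[leb]_(r in `[0, t]) f (r, w r)).

(** The interval is open at [t] so that [[0, T]] is the disjoint union of the
    two domains of integration. *)
Definition future_weight (x : @cadlag R d t T) : R :=
  expR (- (\int[leb]_(r in `]t, T]) f (r, x r)) - g (x T)).

Let T0 : 0 <= T := le_trans t0 tT.

Let mfS a b : 0 <= a -> b <= T ->
  measurable_fun (`[a, b] `*` setT : set (borel (R * 'rV[R]_d)%type)) f.
Proof.
move=> a0 bT; apply: measurable_funS mf.
  apply: closed_borel; rewrite (_ : _ `*` _ = fst @^-1` `[0, T]).
    apply: preimage_closed => [z _|]; first exact: cvg_fst.
    exact: interval_closed.
  by apply/seteqP; split=> z /= => [[]|].
move=> [r x] [/=]; rewrite !in_itv/= => /andP[ar rb] _; split=> //=.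
by rewrite (le_trans a0) ?(le_trans rb).
Qed.

(** Only the process on [[0, t]] enters, so that [measurable_path_integral] can
    be applied to the path space with the sigma-algebra of the past. *)
Lemma measurable_past_weight : measurable_fun setT
  (past_weight : g_sigma_algebraType (@filtr R d T t) -> R).
Proof.
apply: measurableT_comp => //; apply: measurableT_comp => //.
apply: (measurableT_comp (f := fine)) => //.
apply: (@measurable_path_integral _ _ _ (g_sigma_algebraType (@filtr R d T t))
  0 t (fun r (w : cadlag 0 T) => w r)) => //.
- move=> r rt _ B mB; rewrite setTI measurable_sub_sigmaE; last first.
    exact: filtr_sigma_algebra.
  by apply: (coord_sigma_filtr tT); exact: (coord_sigma_preimage rt).
- move=> w r /andP[r0 rt]; have [wr _] := path_of_cadlag w.
  by apply: wr; rewrite r0 (lt_le_trans rt).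
- exact: mfS.
- by move=> r x /andP[r0 rt]; rewrite f0// r0 (le_trans rt).
Qed.

Lemma measurable_future_weight : measurable_fun setT future_weight.
Proof.
apply: measurableT_comp => //; apply: measurable_funB.
  apply: measurableT_comp => //; apply: (measurableT_comp (f := fine)) => //.
  apply: (@measurable_path_integral _ _ _ _ t T
    (fun r (x : cadlag t T) => x r)) => //.
  - by move=> r rt; exact: measurable_coord.
  - by move=> x r rt; have [xr _] := path_of_cadlag x; exact: xr.
  - exact: mfS.
  - exact: subset_itv_oc_cc.
  - by move=> r x /andP[tr rT]; rewrite f0// rT (le_trans t0).
apply: (measurableT_comp mg); apply: measurable_coord.
by rewrite tT lexx.
Qed.

(** Finiteness of the whole integral is needed because the real-valued integral
    is 0 where it diverges, which breaks additivity. *)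
Lemma fk_weight_split (w : @cadlag R d 0 T) :
  (\int[leb]_(r in `[0%R, T]) (f (r, w r))%:E < +oo)%E ->
  fk_weight f g w = past_weight w * future_weight (restr t0 w).
Proof.
rewrite /fk_weight /past_weight /future_weight /Rintegral => fin.
have mfw : measurable_fun `[0, T] (fun r => f (r, w r)).
  apply: (@measurable_path_section _ _ _ _ 0 T
    (fun r (x : @cadlag R d 0 T) => x r) T0 _ _ f mf w).
  - by move=> r rt; exact: measurable_coord.
  - by move=> x r rt; have [xr _] := path_of_cadlag x; exact: xr.
have fw0 r : [set` `[0, T]] r -> (0 <= (f (r, w r))%:E)%E.
  by rewrite /= in_itv lee_fin => /f0.
have E0T : [set` `[0, T]] = [set` `[0, t]] `|` [set` `]t, T]].
  by rewrite -itv_bndbnd_setU// bnd_simp.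
have split_int : (\int[leb]_(r in `[0%R, T]) (f (r, w r))%:E =
    \int[leb]_(r in `[0%R, t]) (f (r, w r))%:E +
    \int[leb]_(r in `]t, T]) (f (r, w r))%:E)%E.
  rewrite E0T ge0_integral_setU//.
  - by rewrite -E0T; exact/measurable_EFinP.
  - by move=> r rt; apply: fw0; rewrite E0T.
  - apply/disj_setPRL => r /=; rewrite !in_itv/= => /andP[tr _].
    by apply/negP; rewrite negb_and -(ltNge t r) tr orbT.
have I1 : (0 <= \int[leb]_(r in `[0%R, t]) (f (r, w r))%:E)%E.
  by apply: integral_ge0 => r rt; apply: fw0; rewrite E0T; left.
have I2 : (0 <= \int[leb]_(r in `]t, T]) (f (r, w r))%:E)%E.
  by apply: integral_ge0 => r rt; apply: fw0; rewrite E0T; right.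
have -> : (\int[leb]_(r in `]t, T]) (f (r, restr t0 w r))%:E =
    \int[leb]_(r in `]t, T]) (f (r, w r))%:E)%E.
  apply: eq_integral => r; rewrite inE/= in_itv/= => /andP[tr _].
  by rewrite (ltW tr).
have -> : restr t0 w T = w T by rewrite /= tT.
have fin1 : (\int[leb]_(r in `[0%R, t]) (f (r, w r))%:E)%E \is a fin_num.
  by rewrite ge0_fin_numE//; apply: le_lt_trans fin; rewrite split_int leeDl.
have fin2 : (\int[leb]_(r in `]t, T]) (f (r, w r))%:E)%E \is a fin_num.
  by rewrite ge0_fin_numE//; apply: le_lt_trans fin; rewrite split_int leeDr.
by rewrite split_int fineD// opprD -expRD addrA.
Qed.

End feynman_kac_density.

(** * The Markov property *)

Lemma markov_property_condexp (R : realType) (d : nat) (T : R)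
    (P : probability (@cadlag R d 0 T) R) (t : R) (t0 : 0 <= t) (tT : t <= T) :
  markov_property P ->
  forall s : @cadlag R d t T -> R,
    measurable_fun setT s -> (forall v, 0 <= s v) ->
    P.-integrable setT (EFin \o (s \o restr t0)) ->
  exists h : borel 'rV[R]_d -> R, [/\ measurable_fun setT h,
    forall x, 0 <= h x & agree_on P (filtr t) (h \o coord_at t) (s \o restr t0)].
Proof.
move=> markovP.
have mX : measurable_fun setT (@coord_at R d 0 T t).
  by apply: measurable_coord; rewrite t0.
have mU := @measurable_restr R d 0 T t t0 tT.
have FX (B : set (borel 'rV[R]_d)) :
    measurable B -> filtr t (@coord_at R d 0 T t @^-1` B).
  by apply: filtr_coord; rewrite t0.
apply: (indic_condexp_integrable (P := P) mX mU (@filtr_measurable R d T t) FX).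
move=> E mE; apply: (markov_indic mX mU (filtr_sigma_algebra _ _)
  (@filtr_measurable _ _ _ _) FX mE).
apply: markovP => //.
exists 1; split => // M M1 v _; rewrite /= indicE ger0_norm//.
by rewrite (le_trans _ (ltW M1))// lern1 leq_b1.
Qed.

Theorem proposition3p7 (R : realType) (d : nat) (d1 : (1 <= d)%N)
    (T : R) (T0 : 0 < T)
    (P : probability (@cadlag R d 0 T) R) (markovP : markov_property P)
    (f : R * 'rV[R]_d -> R)
    (mf : measurable_fun
            (`[0, T] `*` setT : set (borel (R * 'rV[R]_d)%type)) f)
    (f0 : forall (r : R) (x : 'rV[R]_d), 0 <= r <= T -> 0 <= f (r, x))
    (intf : {ae P, forall w : cadlag 0 T,
      (\int[lebesgue_measure]_(r in `[0%R, T]) (f (r, w r))%:E < +oo)%E})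
    (g : 'rV[R]_d -> R)
    (mg : measurable_fun [set: borel 'rV[R]_d] g)
    (intg : P.-integrable [set: cadlag 0 T]
      (fun w : cadlag 0 T => (expR (- g (w T)))%:E))
    (Q : probability (@cadlag R d 0 T) R)
    (QP : forall A : set (cadlag 0 T), measurable A ->
      (Q A = \int[P]_(w in A) (fk_density f g P w)%:E)%E) :
  markov_property Q.
Proof.
move=> t t0 tT F mF bF.
have mX : measurable_fun setT (@coord_at R d 0 T t).
  by apply: measurable_coord; rewrite t0.
have mU := @measurable_restr R d 0 T t t0 tT.
have FX (B : set (borel 'rV[R]_d)) :
    measurable B -> filtr t (@coord_at R d 0 T t @^-1` B).
  by apply: filtr_coord; rewrite t0.
have sF := @filtr_sigma_algebra R d T t.
have FW := @filtr_measurable R d T t.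
apply: (condexp_factored mU sF FW FX mF bF) => M y my yM.
set c := (fine 'E_P[@fk_weight R d T f g])^-1.
have c0 : 0 <= c.
  by rewrite invr_ge0 fine_ge0// expectation_ge0// => w; exact: expR_ge0.
(* The normalising constant is attached to the future factor. *)
pose b (x : @cadlag R d t T) := future_weight f g x * c.
have mb : measurable_fun setT b.
  apply: measurable_funM => //; exact: measurable_future_weight.
have b0 x : 0 <= b x by rewrite mulr_ge0// expR_ge0.
have intb : P.-integrable setT (EFin \o (b \o restr t0)).
  have : P.-integrable setT (fun w : cadlag 0 T => c%:E * (expR (- g (w T)))%:E)%E.
    exact: integrableZl.
  apply: le_integrable => //; first exact/measurable_EFinP/measurableT_comp.
  move=> w _ /=; rewrite lee_fin ger0_norm// ger0_norm ?mulr_ge0 ?expR_ge0//.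
  rewrite /b mulrC ler_wpM2l// /future_weight ler_expR /= tT.
  rewrite -[leRHS]add0r lerD2r oppr_le0.
  apply: fine_ge0; apply: integral_ge0 => r /=; rewrite in_itv/= => /andP[tr rT].
  by rewrite lee_fin f0// rT (le_trans t0)// ltW.
have mK := measurable_past_weight t0 tT mf f0.
have K0 w : 0 <= past_weight (T := T) (t := t) f w by exact: expR_ge0.
apply: (bayes_condexp mX mU sF FW FX _ mK K0 mb b0 intb _ my yM).
  exact: markov_property_condexp.
move=> A mA; rewrite QP//; have mKW := measurable_fun_sub_sigmaW sF FW mK.
apply: ge0_ae_eq_integral => //.
- apply/measurable_funTS/measurable_EFinP; apply: measurable_funM => //.
  exact: measurable_fk_weight (ltW T0) mf f0 mg.
- apply/measurable_funTS/measurable_EFinP; apply: measurable_funM => //.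
  exact: measurableT_comp.
- by move=> w _; rewrite lee_fin mulr_ge0// expR_ge0.
- by move=> w _; rewrite lee_fin mulr_ge0.
- move: intf; apply: filterS => w fin _; congr EFin.
  by rewrite /fk_density (fk_weight_split t0 tT g mf f0 fin) mulrA.
Qed.
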